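(* Let $k\subset K$ be a finite Galois extension of fields of degree $n>2$ with Galois group $G=\mathrm{Aut}_k(K)$. Let $\mathscr{G}$ be the finite étale $k$-group scheme with $\mathscr{G}(L)=\mathrm{Aut}_L(L\otimes_kK)$ for $k$-algebras $L$, let $k_s$ be a separable closure of $k$ and $\Gamma=\mathrm{Gal}(k_s/k)$, acting on $\mathscr{G}(k_s)$ by $\sigma\cdot\varphi=(\sigma\otimes1)\circ\varphi\circ(\sigma\otimes1)^{-1}$. View $G\subseteq\mathscr{G}(k_s)$ via $g\mapsto 1\otimes g$ (so $G=\mathscr{G}(k_s)^\Gamma$). Let $\underline{G}\subseteq\mathscr{G}$ be the finite étale $k$-subgroup scheme whose group of $k_s$-points is the centralizer $C_{\mathscr{G}(k_s)}(G)$, with the restricted $\Gamma$-action. Then $\underline{G}(k_s)\cap G=Z(G)$, the center of $G$. Moreover, $\underline{G}$ is a constant $k$-group if and only if $G$ is abelian, and in this case $\underline{G}=G$.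
   Context: A finite étale $k$-group is constant if $\Gamma$ acts trivially on its group of $k_s$-points; the constant group $G$ here means the constant $k$-subgroup of $\mathscr{G}$ with $k_s$-points $G$. *)

(* Defs.v *)
From HB Require Import structures.
From mathcomp Require Import all_boot all_order all_algebra all_fingroup all_field.
From mathcomp Require Import boolp classical_sets.

Set Implicit Arguments.
Unset Strict Implicit.
Unset Printing Implicit Defensive.

Import GRing.Theory.
Local Open Scope ring_scope.

(* The group Aut_R(A) of automorphisms of an R-algebra A.  The multiplication
   is composition: (f * g) x = f (g x). *)
Record algAut (R : pzRingType) (A : algType R) := AlgAut {
  aut_fun :> A -> A;
  aut_inv : A -> A;
  aut_linear : linear aut_fun;
  aut_1 : aut_fun 1 = 1;
  aut_M : {morph aut_fun : x y / x * y};
  aut_funK : cancel aut_fun aut_inv;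
  aut_invK : cancel aut_inv aut_fun
}.

Section AlgAutGroup.
Variables (R : pzRingType) (A : algType R).
Implicit Types f g h : algAut A.

HB.instance Definition _ f :=
  GRing.isLinear.Build R A A *:%R (aut_fun f) (aut_linear f).
HB.instance Definition _ f :=
  GRing.isMonoidMorphism.Build A A (aut_fun f) (aut_1 f, aut_M f).

Lemma algAut_eq f g : f =1 g -> f = g.
Proof.
case: f g => f f' fL f1 fM fK f'K [g g' gL g1 gM gK g'K] /= fg.
have {}fg : f = g by apply/funext.
subst g; have fg' : f' = g' by apply/funext=> x; rewrite -[x in LHS]g'K fK.
by subst g'; congr AlgAut; apply: Prop_irrelevance.
Qed.

HB.instance Definition _ := gen_eqMixin (algAut A).
HB.instance Definition _ := gen_choiceMixin (algAut A).

Definition algAut_one : algAut A :=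
  @AlgAut R A id id (fun _ _ _ => erefl) erefl (fun _ _ => erefl)
    (fun _ => erefl) (fun _ => erefl).

Fact comp_linear f g : linear (f \o g).
Proof. by move=> a x y; rewrite /= !aut_linear. Qed.
Fact comp_1 f g : (f \o g) 1 = 1.
Proof. by rewrite /= !aut_1. Qed.
Fact comp_M f g : {morph f \o g : x y / x * y}.
Proof. by move=> x y; rewrite /= !aut_M. Qed.

Definition algAut_mul f g : algAut A :=
  AlgAut (@comp_linear f g) (comp_1 f g) (@comp_M f g)
    (can_comp (aut_funK f) (aut_funK g)) (can_comp (aut_invK g) (aut_invK f)).

Fact inv_linear f : linear (aut_inv f).
Proof.
by move=> a x y; apply: (can_inj (aut_funK f)); rewrite aut_linear !aut_invK.
Qed.
Fact inv_1 f : aut_inv f 1 = 1.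
Proof. by apply: (can_inj (aut_funK f)); rewrite aut_1 aut_invK. Qed.
Fact inv_M f : {morph aut_inv f : x y / x * y}.
Proof.
by move=> x y; apply: (can_inj (aut_funK f)); rewrite aut_M !aut_invK.
Qed.

Definition algAut_inv f : algAut A :=
  AlgAut (@inv_linear f) (inv_1 f) (@inv_M f) (aut_invK f) (aut_funK f).

Fact algAut_mulA : associative algAut_mul.
Proof. by move=> f g h; apply: algAut_eq. Qed.
Fact algAut_mul1g : left_id algAut_one algAut_mul.
Proof. by move=> f; apply: algAut_eq. Qed.
Fact algAut_mulg1 : right_id algAut_one algAut_mul.
Proof. by move=> f; apply: algAut_eq. Qed.
Fact algAut_mulVg : left_inverse algAut_one algAut_inv algAut_mul.
Proof. by move=> f; apply: algAut_eq => x /=; rewrite aut_funK. Qed.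
Fact algAut_mulgV : right_inverse algAut_one algAut_inv algAut_mul.
Proof. by move=> f; apply: algAut_eq => x /=; rewrite aut_invK. Qed.

HB.instance Definition _ := isGroup.Build (algAut A)
  algAut_mulA algAut_mul1g algAut_mulg1 algAut_mulVg algAut_mulgV.

End AlgAutGroup.

(* The L-algebra L (x)_k K, in coordinates with respect to a k-basis (b_i) of K:
   the row t stands for \sum_i t_i (x) b_i.  Below, [pure l x] is l (x) x, and
   [tens_lift], [tens_ext] give the universal property of the coproduct of L and
   K in commutative k-algebras, so that the choice of basis is immaterial. *)
Definition tens (k : fieldType) (K : splittingFieldType k) (L : comAlgType k) : Type :=
  'rV[L]_(\dim {:K}).

Section Tensor.
Variables (k : fieldType) (K : splittingFieldType k).
Local Notation n := (\dim {:K}).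
Local Notation b i := ((vbasis {:K})`_(nat_of_ord i)).
Local Notation crd i x := (coord (vbasis {:K}) i x).

Definition pure (L : comAlgType k) (l : L) (x : K) : tens K L :=
  \row_(i < n) (crd i x *: l).

Section Ring.
Variable L : comAlgType k.
Local Notation T := (tens K L).
Implicit Types (l m : L) (x y : K) (t u v : T).

HB.instance Definition _ := GRing.Lmodule.copy T 'rV[L]_n.

Lemma crd_sum x : x = \sum_i crd i x *: b i.
Proof. exact: coord_vbasis (memvf x). Qed.

Lemma pureDl l m x : pure (l + m) x = pure l x + pure m x.
Proof. by apply/rowP=> i; rewrite !mxE scalerDr. Qed.

Lemma pureDr l x y : pure l (x + y) = pure l x + pure l y.
Proof. by apply/rowP=> i; rewrite !mxE linearD scalerDl. Qed.

Lemma pure0l x : pure 0 x = 0 :> T.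
Proof. by apply/rowP=> i; rewrite !mxE scaler0. Qed.

Lemma pure0r l : pure l 0 = 0 :> T.
Proof. by apply/rowP=> i; rewrite !mxE linear0 scale0r. Qed.

Lemma pureZ (a : k) l x : pure l (a *: x) = pure (a *: l) x.
Proof. by apply/rowP=> i; rewrite !mxE linearZ scalerA mulrC. Qed.

Lemma scale_pure l m x : l *: pure m x = pure (l * m) x.
Proof. by apply/rowP=> i; rewrite !mxE scalerAr. Qed.

Lemma pure_suml I (r : seq I) (F : I -> L) x :
  pure (\sum_(i <- r) F i) x = \sum_(i <- r) pure (F i) x.
Proof. exact: (big_morph (fun l => pure l x) (fun l m => pureDl l m x) (pure0l x)). Qed.

Lemma pure_sumr I (r : seq I) (F : I -> K) l :
  pure l (\sum_(i <- r) F i) = \sum_(i <- r) pure l (F i).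
Proof. exact: (big_morph (pure l) (pureDr l) (pure0r l)). Qed.

Lemma tens_sum t : t = \sum_i pure (t 0 i) (b i).
Proof.
apply/rowP=> j; rewrite summxE (bigD1 j) //= big1 => [|i ij]; rewrite mxE.
  by rewrite coord_free ?(basis_free (vbasisP _)) // eqxx scale1r addr0.
by rewrite coord_free ?(basis_free (vbasisP _)) // (negPf ij) scale0r.
Qed.

Lemma tens_ind (P : T -> Prop) :
  P 0 -> (forall t u, P t -> P u -> P (t + u)) ->
  (forall l x, P (pure l x)) -> forall t, P t.
Proof. by move=> P0 PD Pp t; rewrite [t]tens_sum; elim/big_ind: _. Qed.

Definition tens_mul t u : T :=
  \sum_i \sum_j pure (t 0 i * u 0 j) (b i * b j).

Lemma tens_mul_pure l m x y :
  tens_mul (pure l x) (pure m y) = pure (l * m) (x * y).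
Proof.
rewrite {2}[x]crd_sum {2}[y]crd_sum mulr_suml pure_sumr; apply: eq_bigr => i _.
rewrite mulr_sumr pure_sumr; apply: eq_bigr => j _.
by rewrite !mxE -scalerAl -scalerAr scalerA -scalerAl -scalerAr scalerA pureZ.
Qed.

Lemma tens_mulDl : left_distributive tens_mul +%R.
Proof.
move=> t u v; rewrite -big_split; apply: eq_bigr => i _ /=.
by rewrite -big_split; apply: eq_bigr => j _ /=; rewrite mxE mulrDl pureDl.
Qed.

Lemma tens_mulC : commutative tens_mul.
Proof.
move=> t u; rewrite /tens_mul exchange_big /=; apply: eq_bigr => i _.
by apply: eq_bigr => j _; rewrite mulrC [_ * b i]mulrC.
Qed.

Lemma tens_mulDr : right_distributive tens_mul +%R.
Proof. by move=> t u v; rewrite !(tens_mulC t) tens_mulDl. Qed.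

Lemma tens_mul0 t : tens_mul 0 t = 0.
Proof. by apply: (addIr (tens_mul 0 t)); rewrite -tens_mulDl !add0r. Qed.

Lemma tens_mulA : associative tens_mul.
Proof.
have mul0 t : tens_mul t 0 = 0 by rewrite tens_mulC tens_mul0.
elim/tens_ind => [u v|t t' IHt IHt' u v|l x]; first by rewrite !tens_mul0.
  by rewrite !tens_mulDl IHt IHt'.
elim/tens_ind => [v|u u' IHu IHu' v|m y]; first by rewrite !(mul0, tens_mul0).
  by rewrite !(tens_mulDl, tens_mulDr) IHu IHu'.
elim/tens_ind => [|v v' IHv IHv'|o z]; first by rewrite !mul0.
  by rewrite !tens_mulDr IHv IHv'.
by rewrite !tens_mul_pure !mulrA.
Qed.

Lemma tens_mul1 : left_id (pure 1 1) tens_mul.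
Proof.
elim/tens_ind=> [|t u IHt IHu|l x]; first by rewrite tens_mulC tens_mul0.
  by rewrite tens_mulDr IHt IHu.
by rewrite tens_mul_pure !mul1r.
Qed.

Lemma tens_1_neq0 : pure 1 1 != 0 :> T.
Proof.
apply/eqP=> /rowP p0; have /eqP[] := oner_neq0 K.
rewrite [1]crd_sum big1 // => i _; have /eqP := p0 i.
by rewrite !mxE scaler_eq0 oner_eq0 orbF => /eqP->; rewrite scale0r.
Qed.

HB.instance Definition _ := GRing.Zmodule_isComNzRing.Build T
  tens_mulA tens_mulC tens_mul1 tens_mulDl tens_1_neq0.

Lemma pureM l m x y : pure l x * pure m y = pure (l * m) (x * y).
Proof. exact: tens_mul_pure. Qed.

Fact tens_scalerAl (l : L) (t u : T) : l *: (t * u) = (l *: t) * u.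
Proof.
elim/tens_ind: t => [|t t' IHt IHt'|m x]; first by rewrite scaler0 !mul0r scaler0.
  by rewrite mulrDl !scalerDr mulrDl IHt IHt'.
elim/tens_ind: u => [|u u' IHu IHu'|o y]; first by rewrite !mulr0 scaler0.
  by rewrite !mulrDr scalerDr IHu IHu'.
by rewrite scale_pure !pureM scale_pure mulrA.
Qed.

HB.instance Definition _ := GRing.Lmodule_isLalgebra.Build L T tens_scalerAl.
HB.instance Definition _ := GRing.Lalgebra_isComAlgebra.Build L T.

Lemma pure_morphl x y : pure 1 (x * y) = pure 1 x * pure 1 y :> T.
Proof. by rewrite pureM mul1r. Qed.

Lemma tens_sumZ t : t = \sum_i t 0 i *: pure 1 (b i).
Proof. by rewrite {1}[t]tens_sum; apply: eq_bigr => i _; rewrite scale_pure mulr1. Qed.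

Lemma tens_ext (B : comNzRingType) (h h' : {rmorphism T -> B}) :
  (forall l, h (pure l 1) = h' (pure l 1)) ->
  (forall x, h (pure 1 x) = h' (pure 1 x)) -> h =1 h'.
Proof.
move=> hl hx; elim/tens_ind=> [|t u IHt IHu|l x]; first by rewrite !rmorph0.
  by rewrite !rmorphD IHt IHu.
by rewrite -[l]mulr1 -[x]mul1r -pureM !rmorphM /= hl hx.
Qed.

Section Lift.
Variables (B : comNzRingType) (f : {rmorphism L -> B}) (g : {rmorphism K -> B}).
Hypothesis fg : forall a : k, f a%:A = g a%:A.

Definition lift_fun t : B := \sum_i f (t 0 i) * g (b i).

Fact lift_fun_zmod : zmod_morphism lift_fun.
Proof.
move=> t u; rewrite -sumrB; apply: eq_bigr => i _.
by rewrite !mxE rmorphB mulrBl.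
Qed.
HB.instance Definition _ := GRing.isZmodMorphism.Build T B lift_fun lift_fun_zmod.

Lemma lift_pure l x : lift_fun (pure l x) = f l * g x.
Proof.
rewrite {2}[x]crd_sum rmorph_sum mulr_sumr; apply: eq_bigr => i _.
rewrite mxE -mulr_algl -[_ *: b i]mulr_algl !rmorphM fg.
by rewrite [g _ * f _]mulrC -mulrA.
Qed.

Fact lift_fun_monoid : monoid_morphism lift_fun.
Proof.
split=> [|t u]; first by rewrite lift_pure !rmorph1 mulr1.
elim/tens_ind: t => [|t t' IHt IHt'|l x]; first by rewrite !(mul0r, raddf0).
  by rewrite mulrDl !raddfD /= mulrDl IHt IHt'.
elim/tens_ind: u => [|u u' IHu IHu'|m y]; first by rewrite !(mulr0, raddf0).
  by rewrite mulrDr !raddfD /= mulrDr IHu IHu'.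
by rewrite pureM !lift_pure !rmorphM mulrACA.
Qed.
HB.instance Definition _ := GRing.isMonoidMorphism.Build T B lift_fun lift_fun_monoid.

Lemma tens_lift : exists h : {rmorphism T -> B},
  (forall l, h (pure l 1) = f l) /\ (forall x, h (pure 1 x) = g x).
Proof.
by exists lift_fun; split=> [l|x]; rewrite /= lift_pure rmorph1 ?mulr1 ?mul1r.
Qed.
End Lift.

End Ring.

(* The k-group functor L |-> Aut_L(L (x)_k K), on nonzero k-algebras L. *)
Definition autG (L : comAlgType k) := algAut (tens K L).

(* [g_map g] is 1 (x) g : L (x)_k K -> L (x)_k K. *)
Section ConstAut.
Variable L : comAlgType k.
Implicit Type g : gal_of {:K}.

Definition g_map g (t : tens K L) : tens K L := \sum_i t 0 i *: pure 1 (g (b i)).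

Lemma g_map_linear g : linear (g_map g).
Proof.
move=> a t u; rewrite scaler_sumr -big_split; apply: eq_bigr => i _ /=.
by rewrite !mxE scalerDl scalerA.
Qed.
HB.instance Definition _ g := 
  GRing.isLinear.Build L (tens K L) (tens K L) *:%R (g_map g) (g_map_linear g).

Lemma g_map_pure g l x : g_map g (pure l x) = pure l (g x).
Proof.
rewrite {2}[x]crd_sum linear_sum pure_sumr; apply: eq_bigr => i _.
by rewrite mxE scale_pure mulr1 linearZ pureZ.
Qed.

Lemma g_map1 g : g_map g 1 = 1.
Proof. by rewrite g_map_pure rmorph1. Qed.

Lemma g_mapM g : {morph g_map g : t u / t * u}.
Proof.
elim/tens_ind=> [u|t t' IHt IHt' u|l x]; first by rewrite !(mul0r, linear0).
  by rewrite mulrDl !linearD /= mulrDl IHt IHt'.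
elim/tens_ind=> [|u u' IHu IHu'|m y]; first by rewrite !(mulr0, linear0).
  by rewrite mulrDr !linearD /= mulrDr IHu IHu'.
by rewrite pureM !g_map_pure pureM rmorphM.
Qed.

Lemma g_mapK g h : (h * g = 1)%g -> cancel (g_map h) (g_map g).
Proof.
move=> hg; elim/tens_ind=> [|t u IHt IHu|l x]; first by rewrite !linear0.
  by rewrite !linearD /= IHt IHu.
by rewrite !g_map_pure -galM ?memvf // hg gal_id.
Qed.

Definition const_aut g : autG L :=
  AlgAut (@g_map_linear g) (g_map1 g) (@g_mapM g)
    (g_mapK (mulgV g)) (g_mapK (mulVg g)).

(* The image of G = Gal(K/k) in Aut_L(L (x)_k K) under g |-> 1 (x) g.
   The product of 'Gal is composition in the opposite order (galM), so this map
   reverses products; its image and that of the center are unaffected. *)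
Definition const_pts : set (autG L) :=
  [set phi | exists2 g, g \in 'Gal({:K} / 1)%g & phi = const_aut g].

End ConstAut.

(* [tens_map f] is f (x) 1 : L (x)_k K -> L' (x)_k K. *)
Definition tens_map (L L' : comAlgType k) (f : L -> L') (t : tens K L) : tens K L' :=
  map_mx f t.

Section Functor.
Variables (L L' : comAlgType k) (f : {lrmorphism L -> L'}).

Fact tens_map_zmod : zmod_morphism (tens_map f).
Proof. by move=> t u; rewrite /tens_map map_mxB. Qed.
HB.instance Definition _ :=
  GRing.isZmodMorphism.Build (tens K L) (tens K L') (tens_map f) tens_map_zmod.

Lemma tens_map_pure l x : tens_map f (pure l x) = pure (f l) x.
Proof. by apply/rowP=> i; rewrite !mxE linearZ. Qed.

Lemma tens_mapZ l t : tens_map f (l *: t) = f l *: tens_map f t.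
Proof. by apply/rowP=> i; rewrite !mxE rmorphM. Qed.

Fact tens_map_monoid : monoid_morphism (tens_map f).
Proof.
split=> [|t u]; first by rewrite tens_map_pure rmorph1.
elim/tens_ind: t => [|t t' IHt IHt'|l x]; first by rewrite !(mul0r, raddf0).
  by rewrite mulrDl !raddfD /= mulrDl IHt IHt'.
elim/tens_ind: u => [|u u' IHu IHu'|m y]; first by rewrite !(mulr0, raddf0).
  by rewrite mulrDr !raddfD /= mulrDr IHu IHu'.
by rewrite pureM !tens_map_pure pureM rmorphM.
Qed.
HB.instance Definition _ :=
  GRing.isMonoidMorphism.Build (tens K L) (tens K L') (tens_map f) tens_map_monoid.

(* Functoriality of autG: the L'-linear extension of phi along f. *)
Section BaseChange.
Variable phi : tens K L -> tens K L.

Definition bc_fun (t : tens K L') : tens K L' :=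
  \sum_i t 0 i *: tens_map f (phi (pure 1 (b i))).

Lemma bc_linear : linear bc_fun.
Proof.
move=> a t u; rewrite scaler_sumr -big_split; apply: eq_bigr => i _ /=.
by rewrite !mxE scalerDl scalerA.
Qed.
HB.instance Definition _ := 
  GRing.isLinear.Build L' (tens K L') (tens K L') *:%R bc_fun bc_linear.
End BaseChange.

Lemma bc_pure (phi : autG L) l x :
  bc_fun phi (pure l x) = l *: tens_map f (phi (pure 1 x)).
Proof.
rewrite {2}[x]crd_sum pure_sumr !linear_sum raddf_sum scaler_sumr.
apply: eq_bigr => i _; rewrite mxE pureZ -[_ *: 1]mulr1 -scale_pure linearZ /=.
by rewrite tens_mapZ scalerA [f _]linearZ /= rmorph1 -scalerAr mulr1.
Qed.

Lemma bc_map (phi : autG L) t : bc_fun phi (tens_map f t) = tens_map f (phi t).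
Proof.
elim/tens_ind: t => [|t u IHt IHu|l x]; first by rewrite !raddf0.
  by rewrite !raddfD /= IHt IHu.
by rewrite tens_map_pure bc_pure -[l in RHS]mulr1 -scale_pure linearZ tens_mapZ.
Qed.

Lemma bc1 (phi : autG L) : bc_fun phi 1 = 1.
Proof. by rewrite bc_pure !rmorph1 scale1r. Qed.

Lemma bcM (phi : autG L) : {morph bc_fun phi : t u / t * u}.
Proof.
elim/tens_ind=> [u|t t' IHt IHt' u|l x]; first by rewrite !(mul0r, linear0).
  by rewrite mulrDl !linearD /= mulrDl IHt IHt'.
elim/tens_ind=> [|u u' IHu IHu'|m y]; first by rewrite !(mulr0, linear0).
  by rewrite mulrDr !linearD /= mulrDr IHu IHu'.
rewrite pureM !bc_pure pure_morphl !rmorphM.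
by rewrite -scalerAl -scalerAr scalerA.
Qed.

Lemma bcK (phi psi : autG L) : cancel phi psi -> cancel (bc_fun phi) (bc_fun psi).
Proof.
move=> phiK; elim/tens_ind=> [|t u IHt IHu|l x]; first by rewrite !linear0.
  by rewrite !linearD /= IHt IHu.
by rewrite bc_pure linearZ /= bc_map phiK tens_map_pure rmorph1 scale_pure mulr1.
Qed.

Definition base_change (phi : autG L) : autG L' :=
  AlgAut (bc_linear phi) (bc1 phi) (@bcM phi)
    (@bcK phi phi^-1%g (aut_funK phi))
    (@bcK phi^-1%g phi (aut_invK phi)).

End Functor.

(* The action sigma . phi = (sigma (x) 1) o phi o (sigma (x) 1)^-1 of Aut_k(L)
   on Aut_L(L (x)_k K). *)
Section Conj.
Variable L : comAlgType k.
Implicit Types (s : algAut L) (phi : autG L).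

Definition conj_fun s phi (t : tens K L) : tens K L :=
  tens_map s (phi (tens_map (s^-1)%g t)).

Lemma tens_mapK s : cancel (tens_map (s^-1)%g) (tens_map s).
Proof. by move=> t; apply/rowP=> i; rewrite !mxE aut_invK. Qed.

Lemma tens_mapVK s : cancel (tens_map s) (tens_map (s^-1)%g).
Proof. by move=> t; apply/rowP=> i; rewrite !mxE /= aut_funK. Qed.

Lemma conj_linear s phi : linear (conj_fun s phi).
Proof.
move=> a t u; rewrite /conj_fun.
rewrite [X in phi X](_ : _ = (s^-1)%g a *: tens_map (s^-1)%g t + tens_map (s^-1)%g u).
  rewrite linearP; apply/rowP=> i.
  by rewrite !mxE rmorphD rmorphM /= aut_invK.
by apply/rowP=> i; rewrite !mxE rmorphD rmorphM.
Qed.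

Lemma conj1 s phi : conj_fun s phi 1 = 1.
Proof. by rewrite /conj_fun !rmorph1. Qed.

Lemma conjM s phi : {morph conj_fun s phi : t u / t * u}.
Proof. by move=> t u; rewrite /conj_fun !rmorphM. Qed.

Lemma conjK s phi (psi : autG L) : cancel phi psi -> cancel (conj_fun s phi) (conj_fun s psi).
Proof. by move=> phiK t; rewrite /conj_fun tens_mapVK phiK tens_mapK. Qed.

Definition gal_act s phi : autG L :=
  AlgAut (@conj_linear s phi) (conj1 s phi) (@conjM s phi)
    (@conjK s phi phi^-1%g (aut_funK phi))
    (@conjK s phi^-1%g phi (aut_invK phi)).

Lemma gal_actE s phi : gal_act s phi = base_change s phi.
Proof.
apply: algAut_eq => t; rewrite -[t](tens_mapK s) [RHS]bc_map.
by rewrite /= /conj_fun tens_mapK.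
Qed.

End Conj.

(* A is a finite product of finite separable field extensions of k. *)
Definition finite_etale (A : comAlgType k) : Prop :=
  exists (m : nat) (E : 'I_m -> fieldExtType k)
         (p : forall i, {lrmorphism A -> E i}),
    (forall i, separable 1 {:E i}) /\
    (forall e : (forall i, E i), exists! a : A, forall i, p i a = e i).

(* Finite etale k-subgroup schemes of autG, as functors of points.
   The action of Aut_k(ks) on ks-points is base change (gal_actE), so points_map
   makes the ks-points stable under it. *)
Record etale_subgroup := EtaleSubgroup {
  points :> forall L : comAlgType k, set (autG L);
  points_1 : forall L, points (1%g : autG L);
  points_M : forall L (phi psi : autG L),
    points phi -> points psi -> points (phi * psi)%g;
  points_V : forall L (phi : autG L), points phi -> points phi^-1%g;
  points_map : forall (L L' : comAlgType k) (f : {lrmorphism L -> L'}) (phi : autG L),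
    points phi -> points (base_change f phi);
  points_repr : exists (A : comAlgType k) (u : autG A),
    [/\ finite_etale A, points u &
      forall (L : comAlgType k) (phi : autG L), points phi ->
        exists2 f : {lrmorphism A -> L}, base_change f u = phi &
          forall f' : {lrmorphism A -> L}, base_change f' u = phi -> f' =1 f]
}.

End Tensor.

Arguments const_aut {k K} L g.
Arguments const_pts {k} K L _.
Arguments points {k K} _ L _.

Definition centralizer (gT : groupType) (S : set gT) : set gT :=
  [set x | forall y, S y -> commute x y].

Section SeparableClosure.
Variables (k ks : fieldType) (iota : {rmorphism k -> ks}).

Definition is_separable_closure : Prop :=
  (forall x : ks, exists2 p : {poly k}, separable_poly p & root (map_poly iota p) x) /\
  (forall p : {poly ks}, separable_poly p -> (1 < size p)%N -> exists x, root p x).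

(* ks viewed as a k-algebra through iota. *)
Definition extAlg of {rmorphism k -> ks} : Type := ks.
Local Notation A := (extAlg iota).

HB.instance Definition _ := GRing.Field.copy A ks.

Definition ext_scale (a : k) (x : A) : A := iota a * x.

Fact ext_scaleA a a' x : ext_scale a (ext_scale a' x) = ext_scale (a * a') x.
Proof. by rewrite /ext_scale rmorphM mulrA. Qed.
Fact ext_scale1 : left_id 1 ext_scale.
Proof. by move=> x; rewrite /ext_scale rmorph1 mul1r. Qed.
Fact ext_scaleDr : right_distributive ext_scale +%R.
Proof. by move=> a x y; rewrite /ext_scale mulrDr. Qed.
Fact ext_scaleDl x : {morph ext_scale^~ x : a a' / a + a'}.
Proof. by move=> a a'; rewrite /ext_scale rmorphD mulrDl. Qed.
HB.instance Definition _ := GRing.Zmodule_isLmodule.Build k A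
  ext_scaleA ext_scale1 ext_scaleDr ext_scaleDl.

Fact ext_scaleAl (a : k) (x y : A) : a *: (x * y) = (a *: x) * y.
Proof. exact: mulrA. Qed.
HB.instance Definition _ := GRing.Lmodule_isLalgebra.Build k A ext_scaleAl.
HB.instance Definition _ := GRing.Lalgebra_isComAlgebra.Build k A.

(* The absolute Galois group Aut_k(ks) acts trivially on H(ks). *)
Definition is_constant (K : splittingFieldType k) (H : etale_subgroup K) : Prop :=
  forall (s : algAut A) (phi : autG K A), H A phi -> gal_act s phi = phi.

End SeparableClosure.

(* Main.v *)
(* Fix a k-embedding tau of K into ks.  Since the matrix (h (b_i)) of Galois
   conjugates of a basis is invertible, the maps ev_h : l (x) x |-> l tau(h x)
   identify ks (x) K with ks^G, and G acts on the coordinates by translations on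
   one side.  Any ks-linear ring morphism ks (x) K -> ks is one of the ev_h, so
   the centralizer of G consists of the translations on the other side: it is
   G when G is abelian.  The Galois group of ks/k acts on those translations by
   conjugation through its image in G, which is all of G because k-isomorphisms
   between subfields of ks extend to automorphisms (Zorn); so the action is
   trivial exactly when G is abelian.

   For the equality of subgroup schemes, a representable etale subgroup functor
   whose ks-points are G has as L-points the automorphisms \sum_g eps_g (1 (x) g)
   with (eps_g) a complete family of orthogonal idempotents of L, whatever the
   functor. *)
Require Import Defs.
From HB Require Import structures.
From mathcomp Require Import all_boot all_order all_algebra all_fingroup all_solvable all_field.
From mathcomp Require Import boolp classical_sets.

Import GRing.Theory.
Local Open Scope ring_scope.
Local Open Scope classical_set_scope.

Set Implicit Arguments.
Unset Strict Implicit.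
Unset Printing Implicit Defensive.

Local Notation "p ^^ f" := (map_poly f p) (at level 30).

(** * Automorphisms of a separable closure *)

(** Euclidean division by a nonzero polynomial of least size vanishing at [x]. The embedding [i] is
    explicit because one field is later embedded in two ways. *)
Lemma minimal_poly (F L : fieldType) (i : {rmorphism F -> L}) (f : {poly F}) x :
  f != 0 -> root (f ^^ i) x ->
  exists p : {poly F}, forall q, root (q ^^ i) x = (p %| q).
Proof.
move=> f0 fx.
have exn : exists n, `[< exists p : {poly F},
    [/\ p != 0, root (p ^^ i) x & size p = n] >].
  by exists (size f); apply/asboolP; exists f.
case: (ex_minnP exn) => n /asboolP[p [p0 px <-]] minp.
exists p => q; apply/idP/idP=> [qx|/dvdpP[r ->]]; last first.
  by rewrite rmorphM rootM px orbT.
apply/negPn/negP=> npq; have: (size p <= size (q %% p)%R)%N; last first.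
  by apply/negP; rewrite -ltnNge ltn_modp.
apply/minp/asboolP; exists (q %% p); split=> //.
have /rootP := qx; rewrite {1}(divp_eq q p) rmorphD rmorphM hornerD hornerM.
by rewrite (rootP px) mulr0 add0r => /rootP.
Qed.

(** Evaluation at [x] has a prime kernel. If [p'] is the minimal polynomial of [y] and [p = r * p'],
    then [p] divides [r] or [p']. The first makes [p'] a constant with a root, by sizes; so [p] and
    [p'] divide each other. *)
Lemma conjugate_roots (F L ks : fieldType)
    (i1 : {rmorphism F -> L}) (i2 : {rmorphism F -> ks}) (p : {poly F}) x y :
  p != 0 -> (forall q, root (q ^^ i1) x = (p %| q)) -> root (p ^^ i2) y ->
  forall q, root (q ^^ i2) y = root (q ^^ i1) x.
Proof.
move=> p0 pP py q; rewrite pP; apply/idP/idP=> [qy|/dvdpP[r ->]]; last first.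
  by rewrite rmorphM rootM py orbT.
have [p' p'P] := minimal_poly p0 py.
move: (py); rewrite p'P => /dvdpP[r pE].
have r0 : r != 0 by apply: contraNneq p0 => r0; rewrite pE r0 mul0r.
have p'0 : p' != 0 by apply: contraNneq p0 => r0'; rewrite pE r0' mulr0.
have /orP[] : (p %| r) || (p %| p') by rewrite -!pP -rootM -rmorphM -pE pP.
- move=> /dvdp_leq-/(_ r0); rewrite pE size_mul // => le1.
  have : p' %| 1.
    rewrite dvdp1; move: le1; rewrite -subn1 leq_subLR addnC leq_add2r.
    by rewrite eqn_leq => ->; rewrite size_poly_gt0.
  by rewrite -p'P rmorph1 (negPf (root1 _)).
- by move/dvdp_trans; apply; rewrite -p'P.
Qed.

(** Extends an embedding of [F] to the simple extension by [x]: any root of the minimal polynomial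
    of [x] satisfies the same relations as [x]. *)
Lemma root_transport (F L ks : fieldType)
    (i1 : {rmorphism F -> L}) (i2 : {rmorphism F -> ks}) (f : {poly F}) x :
  (forall p : {poly ks}, separable_poly p -> (1 < size p)%N -> exists y, root p y) ->
  separable_poly f -> root (f ^^ i1) x ->
  exists y, forall q, root (q ^^ i2) y = root (q ^^ i1) x.
Proof.
move=> ks_closed sepf fx.
have [p pP] := minimal_poly (separable_poly_neq0 sepf) fx.
have sepp : separable_poly p by rewrite (dvdp_separable _ sepf) // -pP.
have p_gt1 : (1 < size p)%N.
  rewrite ltn_neqAle eq_sym size_poly_gt0 separable_poly_neq0 // andbT.
  by rewrite -dvdp1 -pP rmorph1 root1.
have [||y py] := ks_closed (p ^^ i2); rewrite ?separable_map ?size_map_poly //.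
by exists y; apply: conjugate_roots pP py; apply: separable_poly_neq0.
Qed.

(** Strip factors ['X] from [f] until the constant term [c] is nonzero; then [p(z) * z = - c]. *)
Lemma algebraic_inv (k ks : fieldType) (iota : {rmorphism k -> ks}) (f : {poly k}) z :
  f != 0 -> root (f ^^ iota) z -> z != 0 ->
  exists q : {poly k}, (q ^^ iota).[z] * z = 1.
Proof.
move=> + + z0; elim/poly_ind: f => [|p c IHp]; first by rewrite eqxx.
have [->|c0] := eqVneq c 0.
  rewrite addr0 => pX0; rewrite rmorphM /= map_polyX rootM rootX (negPf z0) orbF.
  by apply: IHp; apply: contraNneq pX0 => ->; rewrite mul0r.
move=> _ /rootP; rewrite rmorphD rmorphM /= map_polyX map_polyC /= !hornerE.
move/eqP; rewrite addr_eq0 => /eqP pz; exists (- c^-1 *: p).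
by rewrite linearZ /= hornerZ -mulrA pz rmorphN fmorphV mulrNN mulVf // fmorph_eq0.
Qed.

(* The graph of a k-isomorphism between two subrings of ks containing k; they are
   subfields by [pa_inv], as ks is algebraic over k. *)
Record partial_aut (k ks : fieldType) (iota : {rmorphism k -> ks})
    (S : set (ks * ks)) : Prop := PartialAut {
  pa_const : forall a, S (iota a, iota a);
  pa_sub : forall s t, S s -> S t -> S (s - t);
  pa_mul : forall s t, S s -> S t -> S (s * t);
  pa_eq0 : forall s, S s -> (s.1 == 0) = (s.2 == 0)
}.

Section PartialAutTheory.
Variables (k ks : fieldType) (iota : {rmorphism k -> ks}).
Hypothesis ksP : is_separable_closure iota.
Implicit Type S : set (ks * ks).

Lemma pa_add S s t : partial_aut iota S -> S s -> S t -> S (s + t).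
Proof.
move=> SP Ss St; rewrite -[t]opprK; apply: (pa_sub SP) => //.
by rewrite -sub0r; apply: (pa_sub SP) => //; rewrite -[0](subrr t); apply: (pa_sub SP).
Qed.

Lemma pa_swap S : partial_aut iota S -> partial_aut iota [set s | S (s.2, s.1)].
Proof.
case=> Sc SB SM S0; split=> //= [[s s'] [t t']|[s s'] [t t']|[s s']].
- exact: SB.
- exact: SM.
- by move/S0 => /= ->.
Qed.

(** The graph of [x |-> y] on the polynomial expressions over [F]; the hypothesis on roots says
    exactly that this is well defined and injective. *)
Lemma pa_image (F : fieldType) (j : {rmorphism k -> F}) (i1 i2 : {rmorphism F -> ks}) x y :
  (forall a, i1 (j a) = iota a) -> (forall a, i2 (j a) = iota a) ->
  (forall q, root (q ^^ i2) y = root (q ^^ i1) x) ->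
  partial_aut iota [set s | exists q, s = ((q ^^ i1).[x], (q ^^ i2).[y])].
Proof.
move=> ij1 ij2 xy; split=> [a|_ _ [p ->] [q ->]|_ _ [p ->] [q ->]|_ [q ->]] /=.
- by exists (j a)%:P; rewrite !map_polyC !hornerC /= ij1 ij2.
- by exists (p - q); rewrite !rmorphB !hornerE.
- by exists (p * q); rewrite !rmorphM !hornerE.
- by have := xy q; rewrite !rootE.
Qed.

Lemma pa_fun S x y y' : partial_aut iota S -> S (x, y) -> S (x, y') -> y = y'.
Proof.
move=> SP Sy Sy'; apply/eqP; rewrite -subr_eq0.
by rewrite -(pa_eq0 SP (pa_sub SP Sy Sy')) /= subrr.
Qed.

Lemma pa_horner S s (q : {poly k}) : partial_aut iota S -> S s ->
  S ((q ^^ iota).[s.1], (q ^^ iota).[s.2]).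
Proof.
move=> SP Ss; elim/poly_ind: q => [|q c IHq].
  by rewrite !rmorph0 !horner0 -(rmorph0 iota); apply: (pa_const SP).
rewrite !rmorphD !rmorphM /= map_polyX map_polyC /= !hornerE.
exact: pa_add (SP) (pa_mul SP IHq Ss) (pa_const SP c).
Qed.

(** The inverse of [s.1] is a polynomial in [s.1] over [k]. Since [S] is functional and contains
    [(1, 1)], the same polynomial inverts [s.2]. *)
Lemma pa_inv S s : partial_aut iota S -> S s -> S (s.1^-1, s.2^-1).
Proof.
move=> SP Ss; have [s10|s10] := eqVneq s.1 0.
  have /esym/eqP s20 := pa_eq0 SP Ss; rewrite s10 eqxx in s20.
  by rewrite s20 s10 invr0 -(rmorph0 iota); apply: (pa_const SP).
have s20 : s.2 != 0 by rewrite -(pa_eq0 SP Ss).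
have [p sepp ps] := ksP.1 s.1.
have [q qs] := algebraic_inv (separable_poly_neq0 sepp) ps s10.
have Sq := pa_horner q SP Ss.
have S1 := pa_const SP 1; rewrite !rmorph1 in S1.
have qs2 : (q ^^ iota).[s.2] * s.2 = 1.
  by apply: (pa_fun SP _ S1); rewrite -qs; apply: (pa_mul SP Sq Ss).
by rewrite -[s.1^-1]mul1r -[s.2^-1]mul1r -{1}qs -qs2 !mulfK.
Qed.

End PartialAutTheory.

Section Extension.
Variables (k ks : fieldType) (iota : {rmorphism k -> ks}) (S : set (ks * ks)).

(** The proofs are parameters so that the subfield structure, which depends on them, can be attached
    to this predicate. *)
Definition pa_dom of is_separable_closure iota & partial_aut iota S : {pred ks} :=
  [pred x | `[< exists y, S (x, y) >]].

Variables (ksP : is_separable_closure iota) (SP : partial_aut iota S).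

Fact pa_dom_divring_closed : divring_closed (pa_dom ksP SP).
Proof.
split=> [|x x' /asboolP[y Sy] /asboolP[y' Sy']|x x' /asboolP[y Sy] /asboolP[y' Sy']];
  apply/asboolP.
- by exists (iota 1); rewrite -(rmorph1 iota); apply: (pa_const SP).
- by exists (y - y'); apply: (pa_sub SP Sy Sy').
- by exists (y / y'); exact: (pa_mul SP Sy (pa_inv ksP SP Sy')).
Qed.
HB.instance Definition _ :=
  GRing.isDivringClosed.Build ks (pa_dom ksP SP) pa_dom_divring_closed.

Record pa_field := PaField { pa_val : ks; _ : pa_val \in pa_dom ksP SP }.
HB.instance Definition _ := [isSub for pa_val].
HB.instance Definition _ := [Choice of pa_field by <:].
HB.instance Definition _ := [SubChoice_isSubIntegralDomain of pa_field by <:].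
HB.instance Definition _ := [SubIntegralDomain_isSubField of pa_field by <:].

Fact pa_img_ex (z : pa_field) : exists y, S (val z, y).
Proof. by case: z => x /= /asboolP. Qed.
Definition pa_img z : ks := projT1 (cid (pa_img_ex z)).
Lemma pa_imgP z : S (val z, pa_img z).
Proof. exact: projT2 (cid (pa_img_ex z)). Qed.

Fact pa_img_zmod : zmod_morphism pa_img.
Proof.
move=> z z'; apply: (pa_fun SP (pa_imgP _) _); rewrite rmorphB /=.
exact: (pa_sub SP (pa_imgP z) (pa_imgP z')).
Qed.
Fact pa_img_monoid : monoid_morphism pa_img.
Proof.
split=> [|z z'].
  apply: (pa_fun SP (pa_imgP _) _); rewrite rmorph1 -(rmorph1 iota).
  exact: pa_const SP 1.
apply: (pa_fun SP (pa_imgP _) _); rewrite rmorphM /=.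
exact: (pa_mul SP (pa_imgP z) (pa_imgP z')).
Qed.
HB.instance Definition _ := GRing.isZmodMorphism.Build pa_field ks pa_img pa_img_zmod.
HB.instance Definition _ := GRing.isMonoidMorphism.Build pa_field ks pa_img pa_img_monoid.

Fact pa_const_dom a : iota a \in pa_dom ksP SP.
Proof. by apply/asboolP; exists (iota a); apply: (pa_const SP). Qed.
Definition pa_cst a := PaField (pa_const_dom a).
Fact pa_cst_zmod : zmod_morphism pa_cst.
Proof. by move=> a b; apply: val_inj; rewrite /= !rmorphB. Qed.
Fact pa_cst_monoid : monoid_morphism pa_cst.
Proof. by split=> [|a b]; apply: val_inj; rewrite /= ?rmorph1 ?rmorphM. Qed.
HB.instance Definition _ := GRing.isZmodMorphism.Build k pa_field pa_cst pa_cst_zmod.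
HB.instance Definition _ := GRing.isMonoidMorphism.Build k pa_field pa_cst pa_cst_monoid.

(** The domain of [S] is a field with two embeddings into [ks], the inclusion and [pa_img]. As [x]
    is separable over [k], it has a conjugate [y] for this pair, and the graph of [x |-> y] over
    that field extends [S]. *)
Lemma pa_extend x : exists S', [/\ partial_aut iota S', S `<=` S' & exists y, S' (x, y)].
Proof.
have ij1 a : \val (pa_cst a) = iota a by [].
have ij2 a : pa_img (pa_cst a) = iota a.
  exact: (pa_fun SP (pa_imgP (pa_cst a)) (pa_const SP a)).
have [p sepp px] := ksP.1 x.
have [||y xy] := @root_transport pa_field ks ks \val pa_img (p ^^ pa_cst) x ksP.2.
- by rewrite separable_map.
- by rewrite -map_poly_comp (eq_map_poly ij1).
exists [set s | exists q : {poly pa_field}, s = ((q ^^ \val).[x], (q ^^ pa_img).[y])].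
split; first exact: pa_image ij1 ij2 xy.
- move=> [u v] Suv; have uP : u \in pa_dom ksP SP by apply/asboolP; exists v.
  exists (PaField uP)%:P; rewrite !map_polyC !hornerC /=; congr pair.
  exact: (pa_fun SP Suv (pa_imgP (PaField uP))).
- by exists y, 'X; rewrite !map_polyX !hornerX.
Qed.
End Extension.

Section Automorphisms.
Variables (k ks : fieldType) (iota : {rmorphism k -> ks}).
Hypothesis ksP : is_separable_closure iota.

Lemma pa_total S0 : partial_aut iota S0 -> exists S,
  [/\ partial_aut iota S, S0 `<=` S, forall x, exists y, S (x, y)
    & forall y, exists x, S (x, y)].
Proof.
move=> S0P.
pose P (S : set (ks * ks)) := S = set0 \/ partial_aut iota S /\ S0 `<=` S.
have [F FP Ftot|S [[S_0|[SP S0S]] maxS]] := @Zorn_bigcup _ P.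
- have [[X FX [XP S0X]]|noX] := pselect (exists2 X, F X & partial_aut iota X /\ S0 `<=` X).
    right; split; last by move=> s /S0X; exists X.
    have gt2 s t : (\bigcup_(Y in F) Y) s -> (\bigcup_(Y in F) Y) t ->
        exists Y, [/\ F Y, partial_aut iota Y, Y s & Y t].
      case=> Y FY Ys [Z FZ Zt]; have [YZ|ZY] := Ftot Y Z FY FZ.
        exists Z; split=> //; last exact: YZ.
        by have [Z0|[]//] := FP _ FZ; move: Zt; rewrite Z0.
      exists Y; split=> //; last exact: ZY.
      by have [Y0|[]//] := FP _ FY; move: Ys; rewrite Y0.
    split=> [a|s t Fs Ft|s t Fs Ft|s Fs].
    + by exists X => //; apply: (pa_const XP).
    + by have [Y [FY YP Ys Yt]] := gt2 s t Fs Ft; exists Y => //; apply: (pa_sub YP).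
    + by have [Y [FY YP Ys Yt]] := gt2 s t Fs Ft; exists Y => //; apply: (pa_mul YP).
    + by have [Y [FY YP Ys _]] := gt2 s s Fs Fs; apply: (pa_eq0 YP).
  left; apply/seteqP; split=> // s [Y FY Ys].
  have [Y0|YP] := FP _ FY; first by move: Ys; rewrite Y0.
  by apply: noX; exists Y.
- have S00 : S0 (iota 0, iota 0) by apply: (pa_const S0P).
  case: (maxS S0 _ (or_intror (conj S0P (@subset_refl _ S0)))).
  by rewrite S_0; apply: conj => [s []|S0s]; exact: (S0s _ S00).
- have {}maxS S' : partial_aut iota S' -> S `<=` S' -> S' `<=` S.
    move=> S'P SS'; apply: contrapT => S'S; case: (maxS S' (conj SS' S'S)).
    by right; split=> //; apply: subset_trans SS'.
  exists S; split=> // [x|y].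
    have [S' [S'P SS' [y S'y]]] := pa_extend ksP SP x.
    by exists y; apply: maxS S'y.
  (* Surjectivity: extend the inverse graph at [y], then swap back and use maximality. *)
  have [S' [S'P SS' [x S'x]]] := pa_extend ksP (pa_swap SP) y.
  exists x; apply: (maxS _ (pa_swap S'P) _ (x, y) S'x) => -[u v] Suv.
  exact: (SS' (v, u) Suv).
Qed.

Lemma extend_aut S0 : partial_aut iota S0 ->
  exists s : algAut (extAlg iota), forall t, S0 t -> s t.1 = t.2.
Proof.
move=> /pa_total[S [SP S0S S1 S2]].
pose f x := projT1 (cid (S1 x)); pose g y := projT1 (cid (S2 y)).
have fP x : S (x, f x) by exact: projT2 (cid (S1 x)).
have gP y : S (g y, y) by exact: projT2 (cid (S2 y)).
have fE x y : S (x, y) -> f x = y by apply: (pa_fun SP (fP x)).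
have fL : linear (f : extAlg iota -> extAlg iota).
  move=> a x y; apply: fE.
  exact: (pa_add SP (pa_mul SP (pa_const SP a) (fP x)) (fP y)).
have f1 : f 1 = 1.
  by apply: fE; rewrite -(rmorph1 iota); apply: (pa_const SP 1).
have fM : {morph (f : extAlg iota -> extAlg iota) : x y / x * y}.
  by move=> x y; apply: fE; exact: (pa_mul SP (fP x) (fP y)).
have fK : cancel f g.
  by move=> x; apply: (pa_fun (pa_swap SP) (gP (f x)) (fP x)).
have gK : cancel g f by move=> y; apply: fE.
exists (@AlgAut k (extAlg iota) f g fL f1 fM fK gK) => -[x y] /S0S Sxy.
exact: fE Sxy.
Qed.

(** Write the minimal polynomial as [q * ('X - x)]. A root [y] of a nonconstant [q] would be the
    image of [x] under an automorphism, so [y = x], against separability. Hence [q] is a constant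
    and [x] is read off the coefficients. *)
Lemma fixed_in_base x :
  (forall s : algAut (extAlg iota), s x = x) -> exists a, iota a = x.
Proof.
move=> xfix; have [f sepf fx] := ksP.1 x.
have [p pP] := minimal_poly (separable_poly_neq0 sepf) fx.
have px : root (p ^^ iota) x by rewrite pP.
have sepp : separable_poly (p ^^ iota).
  by rewrite separable_map (dvdp_separable _ sepf) // -pP.
have [q pE] := factor_theorem _ _ px; rewrite pE separable_root in sepp.
have [sepq qx] := andP sepp.
have [q1|q_gt1] := leqP (size q) 1.
  have /size_poly1P[c c0 qE]: size q == 1%N.
    by rewrite eqn_leq q1 size_poly_gt0 separable_poly_neq0.
  have c1 : iota p`_1 = c.
    by rewrite -coef_map pE qE mul_polyC coefZ coefB coefX coefC subr0 mulr1.
  have c2 : iota p`_0 = - (c * x).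
    by rewrite -coef_map pE qE mul_polyC coefZ coefB coefX coefC sub0r mulrN.
  exists (- (p`_0 / p`_1)).
  by rewrite rmorphN rmorphM fmorphV c1 c2 mulNr opprK mulrAC mulfV // mul1r.
have [y qy] := ksP.2 q sepq q_gt1.
have py : root (p ^^ iota) y by rewrite pE rootM qy.
have p0 : p != 0.
  by apply: separable_poly_neq0; rewrite (dvdp_separable _ sepf) // -pP.
have xy := conjugate_roots (i1 := iota) (i2 := iota) p0 pP py.
have [s sP] := extend_aut (pa_image (j := idfun) (fun=> erefl) (fun=> erefl) xy).
have sxy : s x = y by apply: (sP (x, y)); exists 'X; rewrite !map_polyX !hornerX.
by move: qy; rewrite -sxy xfix (negPf qx).
Qed.
End Automorphisms.

(** * Embeddings and dual bases *)

(** By the primitive element theorem [E = k[x]]; send [q(x)] to [q(y)] for a conjugate [y] of [x] in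
    [ks]. *)
Lemma embed_separable (k ks : fieldType) (iota : {rmorphism k -> ks}) (E : fieldExtType k) :
  is_separable_closure iota -> separable 1 {:E} ->
  inhabited {lrmorphism E -> extAlg iota}.
Proof.
move=> ksP sepE; pose x := separable_generator 1 {:E}.
have [p0 p0P] : exists p, minPoly 1 x = p ^^ in_alg E.
  exact/polyOver1P/minPolyOver.
have sepp0 : separable_poly p0.
  by rewrite -(separable_map (in_alg E)) -p0P; apply: separable_generatorP.
have p0x : root (p0 ^^ in_alg E) x by rewrite -p0P root_minPoly.
have [y xy] := root_transport iota ksP.2 sepp0 p0x.
have gen z : exists q : {poly k}, z = (q ^^ in_alg E).[x].
  have : z \in <<1; x>>%VS.
    by rewrite /x -eq_adjoin_separable_generator ?memvf ?sub1v.
  by case/Fadjoin_polyP=> _ /polyOver1P[q ->] ->; exists q.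
pose pol z := projT1 (cid (gen z)).
have polP z : z = (pol z ^^ in_alg E).[x] by exact: projT2 (cid (gen z)).
pose f (z : E) : extAlg iota := (pol z ^^ iota).[y].
(* Independence of the chosen polynomial: two choices differ by a polynomial vanishing at [x], hence
   at [y]. *)
have fE q : f (q ^^ in_alg E).[x] = (q ^^ iota).[y].
  apply/eqP; rewrite -subr_eq0 -hornerN -hornerD -rmorphB.
  by have := xy (pol (q ^^ in_alg E).[x] - q); rewrite !rootE !rmorphB !hornerE
    -polP subrr eqxx.
have fB : zmod_morphism f.
  move=> z z'; rewrite {1}(polP z) {1}(polP z') -hornerN -hornerD -rmorphB fE.
  by rewrite rmorphB !hornerE.
have fM : monoid_morphism f.
  split=> [|z z']; first by have := fE 1; rewrite !rmorph1 !hornerE.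
  by rewrite {1}(polP z) {1}(polP z') -hornerM -rmorphM fE rmorphM hornerM.
have fZ : scalable f.
  move=> a z; have := fE (a *: pol z).
  by rewrite -mul_polyC !rmorphM /= !map_polyC !hornerE /= -polP mulr_algl.
pose F1 := GRing.isZmodMorphism.Build E (extAlg iota) f fB.
pose F2 := GRing.isMonoidMorphism.Build E (extAlg iota) f fM.
pose F3 := GRing.isScalable.Build k E (extAlg iota) *:%R f fZ.
pose g : {lrmorphism E -> extAlg iota} := HB.pack f F1 F2 F3.
by exists; exact: g.
Qed.

Section DualBasis.
Variables (k : fieldType) (K : splittingFieldType k).
Hypothesis galK : galois 1 {:K}.
Local Notation n := (\dim {:K}).
Local Notation G := (gal_of {:K}).
Local Notation b i := ((vbasis {:K})`_(nat_of_ord i)).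

Lemma mem_gal1 (g : G) : g \in 'Gal({:K} / 1)%g.
Proof.
rewrite gal_kHom ?sub1v //; apply/kAHomP=> _ /vlineP[a ->].
by rewrite linearZ /= rmorph1.
Qed.

Lemma gal_mulE (g h : G) x : (g * h)%g x = h (g x).
Proof. by rewrite galM ?memvf. Qed.

Lemma card_gal1 : #|{: G}| = n.
Proof.
rewrite -[RHS]divn1 -[X in (_ %/ X)%N](dimv1 K) galois_dim //.
by apply: eq_card => g; rewrite mem_gal1.
Qed.

(** The matrix [M] of conjugates of the basis is square, and invertible by independence of
    characters. The column of its inverse at the identity is [e], the other columns are the
    conjugates of [e]; the two identities are the two one-sided inverse relations. *)
Lemma dual_basis : exists e : 'I_n -> K,
  (forall g h : G, \sum_i g (b i) * h (e i) = (g == h)%:R) /\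
  (forall i j, \sum_(g : G) g (e i) * g (b j) = (i == j)%:R).
Proof.
pose h (i : 'I_#|{: G}|) : G := enum_val i.
pose M : 'M[K]_(#|{: G}|, n) := \matrix_(j, i) h j (b i).
have freeM : row_free M.
  apply: inj_row_free => v vM; apply/rowP=> j; rewrite [RHS]mxE.
  (* A relation between the rows, extended from the basis to all of [K] by linearity, is a relation
     between characters. *)
  have sum0 a : a \in {:K}%VS -> \sum_(g : G | true) v 0 (enum_rank g) * g a = 0.
    move=> _; rewrite [a]crd_sum.
    under eq_bigr do rewrite linear_sum mulr_sumr.
    rewrite exchange_big big1 //= => i _.
    under eq_bigr do rewrite linearZ /= -scalerAr.
    rewrite -scaler_sumr; have /rowP/(_ i) := vM; rewrite !mxE => vMi.
    rewrite (reindex h) /=; last exact: (onW_bij _ (enum_val_bij _)).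
    rewrite (eq_bigr (fun j => v 0 j * M j i)) ?vMi ?scaler0 // => l _.
    by rewrite mxE /h enum_valK.
  by rewrite -[j]enum_valK; apply: (gal_independent sum0).
have /row_freeP[B MB] := freeM.
have /row_fullP[C CM] : row_full M by rewrite /row_full (eqP freeM) card_gal1.
have CB : C = B by rewrite -[C]mulmx1 -MB mulmxA CM mul1mx.
pose e i := B i (enum_rank 1%g).
have sum1 (g : G) : \sum_i g (b i) * e i = (g == 1%g)%:R.
  have /matrixP/(_ (enum_rank g) (enum_rank 1%g)) := MB.
  rewrite !mxE (inj_eq enum_rank_inj) => <-.
  by apply: eq_bigr => i _; rewrite mxE /h enum_rankK.
have sumh (g g' : G) : \sum_i g (b i) * g' (e i) = (g == g')%:R.
  rewrite -[g in LHS](mulgKV g').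
  (* Pull [g'] out of each term, which reduces the sum to the identity column. *)
  under eq_bigr do rewrite gal_mulE -rmorphM.
  rewrite -rmorph_sum sum1 rmorph_nat; congr (_%:R); congr nat_of_bool.
  by rewrite -(inj_eq (mulIg g')) mulgKV mul1g.
exists e; split=> // i j.
pose B' : 'M[K]_(n, #|{: G}|) := \matrix_(i, j) h j (e i).
have B'B : B' = B.
  rewrite -[B']mul1mx -CM CB -mulmxA (_ : M *m B' = 1%:M) ?mulmx1 //.
  apply/matrixP=> l l'; rewrite !mxE -[RHS](_ : (h l == h l')%:R = _); last first.
    by rewrite (inj_eq enum_val_inj).
  by rewrite -sumh; apply: eq_bigr => i' _; rewrite !mxE.
have /matrixP/(_ i j) := CM; rewrite CB -B'B !mxE => <-.
rewrite [LHS](reindex h) /=; last exact: (onW_bij _ (enum_val_bij _)).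
by apply: eq_bigr => l _; rewrite !mxE.
Qed.

End DualBasis.

(** * The algebra [ks (x) K] *)

Section ConstAut.
Variables (k : fieldType) (K : splittingFieldType k) (L : comAlgType k).
Local Notation G := (gal_of {:K}).

Lemma pure1_inj : injective (@pure k K L 1).
Proof.
move=> x y /rowP xy; rewrite [x]crd_sum [y]crd_sum; apply: eq_bigr => i _.
have := xy i; rewrite !mxE => /eqP; rewrite -subr_eq0 -scalerBl scaler_eq0.
by rewrite oner_eq0 orbF subr_eq0 => /eqP->.
Qed.

Lemma autG_ext (phi psi : autG K L) :
  (forall x, phi (pure 1 x) = psi (pure 1 x)) -> phi = psi.
Proof.
move=> eq1; apply: algAut_eq; elim/tens_ind=> [|t u IHt IHu|l x].
- by rewrite !linear0.
- by rewrite !linearD /= IHt IHu.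
- by rewrite -[l]mulr1 -scale_pure !linearZ /= eq1.
Qed.

Lemma const_autE (g : G) l x : const_aut L g (pure l x) = pure l (g x).
Proof. exact: g_map_pure. Qed.

Lemma const_aut_inj : injective (@const_aut k K L).
Proof.
move=> g h gh; apply/eqP/gal_eqP => x _; apply: pure1_inj.
by rewrite -!const_autE gh.
Qed.

Lemma const_autM (g h : G) : const_aut L (g * h)%g = (const_aut L h * const_aut L g)%g.
Proof.
apply: autG_ext => x; rewrite const_autE gal_mulE.
by rewrite /= !g_map_pure.
Qed.

Lemma const_ptsE : const_pts K L = range (@const_aut k K L).
Proof.
apply/seteqP; split=> [_ [g _ ->]|_ [g _ <-]]; first by exists g.
by exists g; rewrite ?mem_gal1.
Qed.

End ConstAut.

Section BaseChange.
Variables (k : fieldType) (K : splittingFieldType k).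

Lemma bc_pure1 (L L' : comAlgType k) (f : {lrmorphism L -> L'}) (phi : autG K L) x :
  base_change f phi (pure 1 x) = tens_map f (phi (pure 1 x)).
Proof. by rewrite [LHS]bc_pure scale1r. Qed.

Lemma bc_const (L L' : comAlgType k) (f : {lrmorphism L -> L'}) g :
  base_change f (const_aut L g) = const_aut L' g :> autG K L'.
Proof. by apply: autG_ext => x; rewrite bc_pure1 !const_autE tens_map_pure rmorph1. Qed.

Lemma bc_comp (L L' : comAlgType k) (f : {lrmorphism L -> L'})
    (L'' : comAlgType k) (f' : {lrmorphism L' -> L''}) (phi : autG K L) :
  base_change f' (base_change f phi) = base_change (f' \o f) phi.
Proof.
apply: autG_ext => x; rewrite !bc_pure1.
by apply/rowP=> i; rewrite !mxE.
Qed.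

End BaseChange.

Section Embeddings.
Variables (k : fieldType) (K : splittingFieldType k).
Hypothesis galK : galois 1 {:K}.
Variables (ks : fieldType) (iota : {rmorphism k -> ks}).
Local Notation B := (extAlg iota).
Local Notation T := (tens K B).
Local Notation G := (gal_of {:K}).
Local Notation b i := ((vbasis {:K})`_(nat_of_ord i)).
Variable tau : {lrmorphism K -> B}.
Implicit Types (g h c : G) (t u : T).

Definition ev h : T -> B := lift_fun idfun (tau \o h).

Fact ev_compat h (a : k) : (idfun a%:A : B) = (tau \o h) a%:A.
Proof. by rewrite /= !linearZ /= !rmorph1. Qed.

HB.instance Definition _ h :=
  GRing.isZmodMorphism.Build T B (ev h) (lift_fun_zmod idfun (tau \o h)).
HB.instance Definition _ h :=
  GRing.isMonoidMorphism.Build T B (ev h) (lift_fun_monoid (ev_compat h)).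

Lemma ev_pure h l x : ev h (pure l x) = l * tau (h x).
Proof. exact: (lift_pure (ev_compat h)). Qed.

Lemma evZ h l t : ev h (l *: t) = l * ev h t.
Proof.
by rewrite /ev /lift_fun mulr_sumr; apply: eq_bigr => i _; rewrite mxE mulrA.
Qed.

Lemma ev_const h g t : ev h (const_aut B g t) = ev (g * h)%g t.
Proof.
elim/tens_ind: t => [|t u IHt IHu|l x]; first by rewrite !raddf0.
  by rewrite !raddfD /= IHt IHu.
by rewrite const_autE !ev_pure gal_mulE.
Qed.

(** The dual basis inverts the system of evaluations: it expresses each coordinate of [t] through
    the values [ev h t]. *)
Lemma ev_inj t u : (forall h, ev h t = ev h u) -> t = u.
Proof.
have [e [_ sum_h]] := dual_basis galK; move=> tu; apply/rowP=> j.
have coef (v : T) : v 0 j = \sum_(h : G) tau (h (e j)) * ev h v.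
  transitivity (\sum_i v 0 i * tau (i == j)%:R).
    rewrite (bigD1 j) //= big1 => [|i /negPf->]; last by rewrite rmorph0 mulr0.
    by rewrite eqxx rmorph1 mulr1 addr0.
  under eq_bigr do rewrite eq_sym -sum_h rmorph_sum mulr_sumr.
  rewrite exchange_big; apply: eq_bigr => h _; rewrite mulr_sumr.
  by apply: eq_bigr => i _; rewrite rmorphM mulrCA.
by rewrite !coef; apply: eq_bigr => h _; rewrite tu.
Qed.

(** The primitive idempotents of [ks^G], written with the dual basis. *)
Lemma ev_idem : exists eps : G -> T, forall g h, ev h (eps g) = (g == h)%:R.
Proof.
have [e [sum_i _]] := dual_basis galK.
exists (fun g => \sum_i pure (tau (g (e i))) (b i)) => g h.
rewrite raddf_sum eq_sym -(rmorph_nat tau) -sum_i rmorph_sum.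
by apply: eq_bigr => i _; rewrite /= ev_pure rmorphM mulrC.
Qed.

(* The automorphism of [ks (x) K = ks^G] permuting coordinates by translation
   on the side opposite to [const_aut]. *)
Lemma translation c : exists phi : autG K B, forall h t, ev h (phi t) = ev (h * c)%g t.
Proof.
have [eps epsP] := ev_idem.
pose f c t : T := \sum_(g : G) ev (g * c)%g t *: eps g.
have fE d h t : ev h (f d t) = ev (h * d)%g t.
  rewrite raddf_sum (bigD1 h) //= big1 => [|g /negPf gh]; rewrite evZ epsP.
    by rewrite eqxx mulr1 addr0.
  by rewrite gh mulr0.
have fL : linear (f c).
  by move=> a t u; apply: ev_inj => h; rewrite fE !raddfD /= !evZ !fE.
have f1 : f c 1 = 1 by apply: ev_inj => h; rewrite fE !rmorph1.
have fM : {morph f c : t u / t * u}.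
  by move=> t u; apply: ev_inj => h; rewrite fE !rmorphM /= !fE.
have fK : cancel (f c) (f (c^-1)%g).
  by move=> t; apply: ev_inj => h; rewrite !fE mulgKV.
have fVK : cancel (f (c^-1)%g) (f c).
  by move=> t; apply: ev_inj => h; rewrite !fE mulgK.
by exists (AlgAut fL f1 fM fK fVK) => h t; apply: fE.
Qed.

(** Left and right translations commute: [const_aut] turns [h] into [g * h], while [phi] turns it
    into [h * c]. *)
Lemma translation_central (phi : autG K B) c :
  (forall h t, ev h (phi t) = ev (h * c)%g t) -> centralizer (const_pts K B) phi.
Proof.
move=> phiE psi; rewrite const_ptsE => -[g _ <-]; apply: algAut_eq => t.
by apply: ev_inj => h; rewrite /= phiE !ev_const phiE mulgA.
Qed.

(* [phi] is [ks]-linear, so [ev 1 \o phi] is a point of [Spec (ks (x) K)]: it is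
   nonzero on some idempotent of the decomposition, hence equal to some [ev c]. *)
Lemma ev_point (phi : autG K B) : exists c, forall t, ev 1%g (phi t) = ev c t.
Proof.
have [eps epsP] := ev_idem.
have sum_eps : \sum_(g : G) eps g = 1.
  apply: ev_inj => h; rewrite raddf_sum rmorph1 (bigD1 h) //= epsP eqxx.
  by rewrite big1 ?addr0 // => g /negPf gh; rewrite epsP gh.
have mul_eps t g : t * eps g = ev g t *: eps g.
  apply: ev_inj => h; rewrite rmorphM /= evZ !epsP.
  by have [->|_] := eqVneq g h; rewrite ?mulr0.
have [c c0] : exists c, ev 1%g (phi (eps c)) != 0.
  apply: contrapT => no_c; have /eqP[] := oner_neq0 B.
  rewrite -(rmorph1 (ev 1%g)) -(rmorph1 phi) -sum_eps !raddf_sum big1 // => g _.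
  by apply/eqP/negPn/negP=> g0; apply: no_c; exists g.
(* Apply [ev 1 \o phi] to [t * eps c = ev c t *: eps c] and cancel the nonzero value at [eps c]. *)
exists c => t; apply: (mulIf c0).
by rewrite -rmorphM -[_ * _]rmorphM mul_eps /= linearZ /= evZ.
Qed.

(** The coordinate at [1] gives [c]; commuting with [const_aut B h] carries this to the coordinate
    at [h], so [phi] is right translation by [c]. For [G] abelian this is left translation, that is
    [const_aut B c]. *)
Lemma centralizer_abelian (phi : autG K B) :
  abelian 'Gal({:K} / 1)%g -> centralizer (const_pts K B) phi -> const_pts K B phi.
Proof.
move=> abG cphi; have [c cP] := ev_point phi.
rewrite const_ptsE; exists c => //; apply: algAut_eq => t; apply: ev_inj => h.
have cph : commute phi (const_aut B h) by apply: cphi; rewrite const_ptsE; exists h.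
have := congr1 (fun psi : autG K B => ev 1%g (psi t)) cph.
rewrite /= cP !ev_const mulg1 => <-.
by rewrite (centsP abG) ?mem_gal1.
Qed.

(** If [s] restricts to [a] on [K], then [s (x) 1] applies [s] to the coordinates and translates
    their indices by [a] on the right. *)
Lemma ev_gal_act (s : algAut B) (a : G) h t :
  (forall x, s (tau x) = tau (a x)) ->
  ev (h * a)%g (tens_map s t) = s (ev h t).
Proof.
move=> sa; elim/tens_ind: t => [|t u IHt IHu|l x]; first by rewrite !raddf0.
  by rewrite !raddfD /= IHt IHu.
by rewrite tens_map_pure !ev_pure rmorphM /= sa gal_mulE.
Qed.

End Embeddings.

(** * Points of etale subgroups *)

Lemma extend_gal (k ks : fieldType) (iota : {rmorphism k -> ks})
    (K : splittingFieldType k) (tau : {lrmorphism K -> extAlg iota}) (a : gal_of {:K}) :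
  is_separable_closure iota ->
  exists s : algAut (extAlg iota), forall x, s (tau x) = tau (a x).
Proof.
move=> ksP.
have tauE (f : {lrmorphism K -> extAlg iota}) c : f (in_alg K c) = iota c.
  by rewrite linearZ /= rmorph1; apply: mulr1.
(* Taking the point [0] on both sides adjoins nothing to [K]: the values [q(0)] are the constant
   terms, so the graph is that of [tau x |-> tau (a x)]. *)
have xy (q : {poly K}) : root (q ^^ (tau \o a)) (0 : ks) = root (q ^^ tau) (0 : ks).
  by rewrite !rootE !horner_coef0 !coef_map !fmorph_eq0.
have [s sP] := extend_aut ksP (@pa_image k ks iota K (in_alg K) tau (tau \o a) 0 0
  (tauE tau) (tauE (tau \o a)) xy).
exists s => x; apply: (sP (tau x, tau (a x))); exists x%:P.
by rewrite !map_polyC !hornerC.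
Qed.

(** * Subgroups whose [ks]-points are the constant automorphisms *)

Section Descent.
Variables (k : fieldType) (K : splittingFieldType k).
Local Notation G := (gal_of {:K}).

(** The [L]-points of the constant group scheme: a family [eps] is a locally constant map from
    [Spec L] to [G]. *)
Definition locally_constant (L : comAlgType k) (phi : autG K L) : Prop :=
  exists eps : G -> L, [/\ \sum_(g : G) eps g = 1,
    forall g h, eps g * eps h = eps g *+ (g == h)
    & forall x, phi (pure 1 x) = \sum_(g : G) eps g *: pure 1 (g x)].

Lemma locally_constant_bc (L L' : comAlgType k) (f : {lrmorphism L -> L'}) (phi : autG K L) :
  locally_constant phi -> locally_constant (base_change f phi).
Proof.
case=> eps [eps1 epsM phiE]; exists (f \o eps); split=> [/=|g h /=|x].
- by rewrite -rmorph_sum eps1 rmorph1.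
- by rewrite -rmorphM epsM rmorphMn.
- rewrite bc_pure1 phiE raddf_sum; apply: eq_bigr => g _.
  by rewrite /= tens_mapZ tens_map_pure rmorph1.
Qed.

Variables (ks : fieldType) (iota : {rmorphism k -> ks}).
Hypothesis ksP : is_separable_closure iota.
Local Notation B := (extAlg iota).
Variable H : etale_subgroup K.

(** It suffices to treat the universal point [u] over [A], a product of fields [E i]. Embedded in
    [ks], each factor turns [u] into some [1 (x) g], and equalities in [A] can be tested in these
    embeddings. *)
Lemma points_locally_constant (L : comAlgType k) (phi : autG K L) :
  H B `<=` const_pts K B -> H L phi -> locally_constant phi.
Proof.
have [A [u [[m [E [p [sepE prodE]]]] Hu univ]]] := points_repr H.
move=> HB /univ[f <- _]; apply: locally_constant_bc => {f univ phi L}.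
have inj_p a a' : (forall i, p i a = p i a') -> a = a'.
  by move=> aa'; have [a0 [_ a0P]] := prodE (fun i => p i a'); rewrite -(a0P a) // -(a0P a').
have ex_j i : exists _ : {lrmorphism E i -> B}, True.
  by have [j] := embed_separable ksP (sepE i); exists j.
pose j i := projT1 (cid (ex_j i)).
pose f i : {lrmorphism A -> B} := j i \o p i.
have /choice[gam gamP] i : exists g : G, base_change (f i) u = const_aut B g.
  have /HB := points_map (f i) Hu.
  by rewrite const_ptsE => -[g _ <-]; exists g.
(* [eps g] is the indicator of the factors on which [u] becomes [1 (x) g]. *)
have /choice[eps epsP] (g : G) : exists a : A, forall i, p i a = (gam i == g)%:R.
  by have [a [aP _]] := prodE (fun i => (gam i == g)%:R); exists a.
exists eps; split=> [|g h|x].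
- apply: inj_p => i; rewrite rmorph_sum rmorph1 (bigD1 (gam i)) //= epsP eqxx.
  by rewrite big1 ?addr0 // => g /negPf gi; rewrite epsP eq_sym gi.
- apply: inj_p => i; rewrite rmorphM rmorphMn /= !epsP.
  have [<-|_] := eqVneq (gam i) g; last by rewrite mul0r mul0rn.
  by case: eqP => _; rewrite mul1r.
have eq_f i : tens_map (f i) (u (pure 1 x)) =
    tens_map (f i) (\sum_(g : G) eps g *: pure 1 (g x)).
  rewrite -bc_pure1 gamP const_autE raddf_sum (bigD1 (gam i)) //=.
  rewrite tens_mapZ tens_map_pure rmorph1 /= epsP eqxx rmorph1 scale1r.
  rewrite big1 ?addr0 // => g /negPf gi.
  by rewrite tens_mapZ /= epsP eq_sym gi rmorph0 scale0r.
apply/rowP=> l; apply: inj_p => i; apply: (fmorph_inj (j i)).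
by have /rowP/(_ l) := eq_f i; rewrite !mxE.
Qed.

(* By uniqueness in [points_repr] the [ks]-point [1 (x) g] of the representing
   algebra is Galois invariant, hence takes values in [k]; the idempotents glue
   these [k]-points into an [L]-point. *)
Lemma locally_constant_points (L : comAlgType k) (phi : autG K L) :
  const_pts K B `<=` H B -> locally_constant phi -> H L phi.
Proof.
have [A [u [_ Hu univ]]] := points_repr H => HB [eps [eps1 epsM phiE]].
have /choice[chi chiP] (g : G) : exists chi : A -> k, exists f : {lrmorphism A -> B},
    base_change f u = const_aut B g /\ forall a, iota (chi a) = f a.
  have /univ[f fu f_uniq] : H B (const_aut B g) by apply: HB; rewrite const_ptsE; exists g.
  have /choice[chi chiP] a : exists c, iota c = f a.
    (* Base change along [s] fixes [1 (x) g], so [s \o f] classifies the same point as [f]. *)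
    apply: (fixed_in_base ksP) => s; apply: (f_uniq (s \o f)).
    by rewrite -bc_comp fu bc_const.
  by exists chi, f.
have iotaE (c : k) : c%:A = iota c :> B by apply: mulr1.
have chiB g : zmod_morphism (chi g).
  have [f [_ fE]] := chiP g; move=> a b; apply: (fmorph_inj iota).
  by rewrite rmorphB !fE raddfB.
have chiM g : monoid_morphism (chi g).
  have [f [_ fE]] := chiP g; split=> [|a b]; apply: (fmorph_inj iota).
    by rewrite fE !rmorph1.
  by rewrite rmorphM !fE rmorphM.
have chiZ g c a : chi g (c *: a) = c * chi g a.
  have [f [_ fE]] := chiP g; apply: (fmorph_inj iota).
  by rewrite rmorphM !fE linearZ.
pose F (a : A) : L := \sum_(g : G) chi g a *: eps g.
have FB : zmod_morphism F.
  by move=> a b; rewrite /F -sumrB; apply: eq_bigr => g _; rewrite chiB scalerBl.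
have FM : monoid_morphism F.
  split=> [|a b].
    by rewrite -eps1; apply: eq_bigr => g _; rewrite (chiM g).1 scale1r.
  rewrite mulr_suml; apply: eq_bigr => g _; rewrite mulr_sumr (bigD1 g) //=.
  rewrite big1 => [|h /negPf hg].
    by rewrite addr0 -scalerAl -scalerAr epsM eqxx mulr1n scalerA (chiM g).2.
  by rewrite -scalerAl -scalerAr epsM eq_sym hg mulr0n !scaler0.
have FZ : scalable F.
  by move=> c a; rewrite scaler_sumr; apply: eq_bigr => g _; rewrite chiZ scalerA.
pose F1 := GRing.isZmodMorphism.Build A L F FB.
pose F2 := GRing.isMonoidMorphism.Build A L F FM.
pose F3 := GRing.isScalable.Build k A L *:%R F FZ.
pose f : {lrmorphism A -> L} := HB.pack F F1 F2 F3.
rewrite (_ : phi = base_change f u); first exact: points_map.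
apply: autG_ext => x; rewrite bc_pure1 phiE; apply/rowP=> l.
rewrite summxE mxE /= /F; apply: eq_bigr => g _.
(* [chi g] sends the coordinates of [u (1 (x) x)] to those of [g x]; this is seen in [ks] and
   descends as [iota] is injective. *)
have [f' [f'u f'E]] := chiP g.
have := congr1 (fun psi : autG K B => psi (pure 1 x)) f'u.
rewrite bc_pure1 const_autE => /rowP/(_ l); rewrite !mxE iotaE -f'E.
by move/fmorph_inj => ->; rewrite -scalerAr mulr1.
Qed.

End Descent.

Theorem theorem4p4 (k : fieldType) (K : splittingFieldType k)
    (galK : galois 1 {:K}) (n_gt2 : (2 < \dim {:K})%N)
    (ks : fieldType) (iota : {rmorphism k -> ks})
    (ksP : is_separable_closure iota)
    (uG : etale_subgroup K)
    (uGP : uG (extAlg iota) = centralizer (const_pts K (extAlg iota))) :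
  [/\ uG (extAlg iota) `&` const_pts K (extAlg iota) =
        [set phi | exists2 z, z \in 'Z('Gal({:K} / 1))%g
                            & phi = const_aut (extAlg iota) z],
      is_constant iota uG <-> abelian 'Gal({:K} / 1)%g
    & abelian 'Gal({:K} / 1)%g ->
        uG (extAlg iota) = const_pts K (extAlg iota) /\
        (forall cG : etale_subgroup K, is_constant iota cG ->
           cG (extAlg iota) = const_pts K (extAlg iota) ->
           forall L : comAlgType k, uG L = cG L)].
Proof.
set B := extAlg iota.
have [tau] : inhabited {lrmorphism K -> B}.
  by apply: embed_separable => //; case/and3P: galK.
have commuteE (g h : gal_of {:K}) :
    commute (const_aut B g) (const_aut B h) <-> commute g h.
  rewrite /commute -!const_autM; split=> [/const_aut_inj|] -> //.
have uG_abelian : abelian 'Gal({:K} / 1)%g -> uG B = const_pts K B.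
  move=> abG; rewrite uGP; apply/seteqP; split=> phi.
    exact: (centralizer_abelian galK tau abG).
  rewrite const_ptsE => -[g _ <-] _ [h _ <-]; apply/commuteE.
  by apply: (centsP abG); rewrite mem_gal1.
split.
- rewrite uGP const_ptsE; apply/seteqP; split=> [phi [+ [g _ gE]]|_ [z /centerP[_ zP] ->]].
    rewrite -{phi}gE => cg; exists g => //; apply/centerP; split=> [|h _]; first exact: mem_gal1.
    by apply/commuteE/cg; exists h.
  split; last by exists z.
  by move=> _ [h _ <-]; apply/commuteE/zP/mem_gal1.
- split=> [cstG|abG s phi]; last first.
    by rewrite uG_abelian // const_ptsE => -[g _ <-]; rewrite gal_actE bc_const.
  (* With [phi] the translation by [c] and [s] extending [a], the coordinate at [a] of
     [s . phi = phi], evaluated at [1 (x) x], compares [c * a] with [a * c] on [x]. *)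
  apply/centsP=> a _ c _; apply/eqP/gal_eqP=> x _; apply: (fmorph_inj tau).
  have [phi phiE] := translation galK tau c.
  have [s sa] := extend_gal tau a ksP.
  have /(cstG s) phi_s : uG B phi by rewrite uGP; apply: translation_central phiE.
  have := congr1 (fun psi : autG K B => ev tau a (psi (tens_map s (pure 1 x)))) phi_s.
  have E : ev tau a (tens_map s (phi (pure 1 x))) = ev tau (c * a)%g (tens_map s (pure 1 x)).
    by rewrite -[a in LHS]mul1g !(ev_gal_act _ _ sa) phiE mul1g.
  by rewrite phiE /= /conj_fun tens_mapVK E tens_map_pure rmorph1 !ev_pure !mul1r.
- move=> abG; split=> [|cG _ cGP L]; first exact: uG_abelian.
  (* Both subgroups have [ks]-points [G], so a point of either one is locally constant and therefore
     a point of the other. *)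
  apply/seteqP; split=> phi /(points_locally_constant ksP) phiP;
    apply: (locally_constant_points ksP); rewrite ?cGP ?uG_abelian //;
    by apply: phiP; rewrite ?cGP ?uG_abelian.
Qed.
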